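(* Consider the fluid model with parameters $\mathbf{\Lambda}$, $\lambda_0$, $\mathbf{G}$ described in the context, with $\mathbf{M}=\mathbf{G}^{-1}\mathbf{\Lambda}$ and $\mathbf{H}=\mathbf{G}\mathbf{M}\mathbf{G}^{-1}$. If $\rho(\mathbf{M})<1$, then $$f(t)=\mathbf{e}^{\top}(\mathbf{I}-\mathbf{H}^{\top})^{-1}\mathbf{G}^{-1}\mathbf{Q}(t)$$ is a Lyapunov function for the fluid model.
   Context: Fix $K\ge 1$, a matrix $\mathbf{\Lambda}=(\lambda_{ij})_{i,j=1}^K$ with $\lambda_{ij}\ge 0$, a column vector $\lambda_0=(\lambda_{01},\dots,\lambda_{0K})^\top$ with $\lambda_{0j}\ge0$, and $\mathbf{G}=\mathrm{diag}(\mu_1,\dots,\mu_K)$ with $\mu_i\in(0,\infty)$. Set $\mathbf{M}=\mathbf{G}^{-1}\mathbf{\Lambda}$, let $\rho(\cdot)$ denote the spectral radius (the dominant, Perron eigenvalue of a nonnegative matrix), $\mathbf{I}$ the identity matrix, and $\mathbf{e}=(1,\dots,1)^\top\in\mathbb{R}^K$. Fluid model. A fluid solution is a triple $(\mathbf{Q},\mathbf{T},Y)$ of functions on $[0,\infty)$, with $\mathbf{Q}=(Q_1,\dots,Q_K)^\top$, $\mathbf{T}=(T_1,\dots,T_K)^\top$, such that: each $T_i$ is nondecreasing with $T_i(0)=0$; $Y(t)=t-\sum_{i=1}^K T_i(t)$ is nondecreasing (so each $T_i$ is Lipschitz); $Q_i(t)\ge 0$ for all $i,t$; with $\mathbf{D}(t)=\mathbf{G}\mathbf{T}(t)$,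 $$\mathbf{Q}(t)=\mathbf{Q}(0)+(\mathbf{M}^\top-\mathbf{I})\mathbf{D}(t)+Y(t)\lambda_0,\qquad t\ge 0;$$ and the discipline is non-idling: $\sum_{i=1}^K\dot T_i(t)=1$ at almost every $t$ for which $\mathbf{Q}(t)\ne\mathbf{0}$. ($Q_i(t)$ is the amount of class $i$ fluid, $T_i(t)$ the time devoted to class $i$ in $[0,t]$, $Y$ the idle time.) A function $f$ of the form $f(t)=h(\mathbf{Q}(t))$ is a Lyapunov function for the fluid model if, for every fluid solution, $f(t)\ge 0$, $f(t)=0$ if and only if $\mathbf{Q}(t)=\mathbf{0}$, $f$ is absolutely continuous, and there is $\varepsilon>0$ (the same for all fluid solutions) such that $\dot f(t)\le-\varepsilon$ at almost every $t>0$ at which $\mathbf{Q}(t)\neq\mathbf{0}$. *)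

(* Defs.v *)
From HB Require Import structures.
From mathcomp Require Import all_boot all_order all_algebra.
From mathcomp Require Import all_classical all_reals all_analysis.
From mathcomp Require Import complex.

Set Implicit Arguments.
Unset Strict Implicit.
Unset Printing Implicit Defensive.

Import Order.TTheory GRing.Theory Num.Theory.
Import numFieldNormedType.Exports.

Local Open Scope classical_set_scope.
Local Open Scope ring_scope.

(* The supremum is a maximum: the spectrum is finite, and nonempty for K > 0. *)
Definition spectral_radius (R : realType) (K : nat) (A : 'M[R]_K) : R :=
  sup [set ComplexField.Normc.normc z |
       z in [set z : R[i] | eigenvalue (map_mx (real_complex R) A) z]].

(* J is meant to be an interval, possibly unbounded; then a single delta must
   work on the whole of J. *)
Definition absolutely_continuous_on (R : realType) (J : set R) (f : R -> R) :
    Prop :=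
  forall eps : R, 0 < eps -> exists2 delta : R, 0 < delta &
    forall (n : nat) (a b : 'I_n -> R),
      (forall i, [/\ J (a i), J (b i) & a i <= b i]) ->
      trivIset setT (fun i => `]a i, b i[%classic) ->
      \sum_(i < n) (b i - a i) < delta ->
      \sum_(i < n) `|f (b i) - f (a i)| < eps.

Definition rate_mx (R : realType) (K : nat) (mu : 'rV[R]_K) : 'M[R]_K :=
  diag_mx mu.

Definition mean_mx (R : realType) (K : nat) (Lambda : 'M[R]_K)
    (mu : 'rV[R]_K) : 'M[R]_K :=
  invmx (rate_mx mu) *m Lambda.

Definition conj_mean_mx (R : realType) (K : nat) (Lambda : 'M[R]_K)
    (mu : 'rV[R]_K) : 'M[R]_K :=
  rate_mx mu *m mean_mx Lambda mu *m invmx (rate_mx mu).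

(* Q, T and Y are functions on [0, +oo[: their values at negative times are
   irrelevant. In the non-idling condition [derive1] is the total derivative
   operator; the conditions on T and Y make every T_i Lipschitz on [0, +oo[,
   hence differentiable almost everywhere there, so that differentiability need
   not be demanded separately. *)
Record fluid_solution (R : realType) (K : nat) (Lambda : 'M[R]_K)
    (lambda0 : 'cV[R]_K) (mu : 'rV[R]_K)
    (Q T : R -> 'cV[R]_K) (Y : R -> R) : Prop := FluidSolution {
  fluid_T0 : forall i, T 0 i 0 = 0;
  fluid_T_nondecreasing :
    forall i s t, 0 <= s -> s <= t -> T s i 0 <= T t i 0;
  fluid_Y_def : forall t, 0 <= t -> Y t = t - \sum_i T t i 0;
  fluid_Y_nondecreasing : forall s t, 0 <= s -> s <= t -> Y s <= Y t;
  fluid_Q_ge0 : forall t i, 0 <= t -> 0 <= Q t i 0;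
  fluid_equation : forall t, 0 <= t ->
    Q t = Q 0 + ((mean_mx Lambda mu)^T - 1%:M) *m (rate_mx mu *m T t)
          + Y t *: lambda0;
  fluid_non_idling : {ae lebesgue_measure, forall t : R, 0 < t -> Q t != 0 ->
    \sum_i derive1 (fun s : R => T s i 0) t = 1}
}.

(* Here an almost-everywhere bound on the derivative does include
   differentiability. *)
Definition lyapunov_function (R : realType) (K : nat) (Lambda : 'M[R]_K)
    (lambda0 : 'cV[R]_K) (mu : 'rV[R]_K) (h : 'cV[R]_K -> R) : Prop :=
  (forall (Q T : R -> 'cV[R]_K) (Y : R -> R),
     fluid_solution Lambda lambda0 mu Q T Y ->
     [/\ forall t, 0 <= t -> 0 <= h (Q t),
         forall t, 0 <= t -> (h (Q t) = 0 <-> Q t = 0) &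
         absolutely_continuous_on `[0, +oo[%classic (fun t => h (Q t))]) /\
  exists2 eps : R, 0 < eps &
    forall (Q T : R -> 'cV[R]_K) (Y : R -> R),
      fluid_solution Lambda lambda0 mu Q T Y ->
      {ae lebesgue_measure, forall t : R, 0 < t -> Q t != 0 ->
        derivable (fun s : R => h (Q s)) t 1 /\
        derive1 (fun s : R => h (Q s)) t <= - eps}.

(* Main.v *)
(* The row vector w = e^T (I - H^T)^-1 G^-1 is e^T G^-1 (I - M^T)^-1, so that
   w (I - M^T) G = e^T and the fluid equation collapses to
     w Q(t) = w Q(0) - t + (1 + w lambda_0) Y(t).
   Nonnegativity of w Q, and its vanishing only at Q = 0, amount to w > 0, which
   follows from (I - M)^-1 >= 0; only the absence of real eigenvalues >= 1 of M
   is needed for that. The Lipschitz bound on Y gives absolute continuity. Each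
   T_i is nondecreasing and 1-Lipschitz, so its Lebesgue-Stieltjes measure is
   dominated by Lebesgue measure, and the Radon-Nikodym and Lebesgue
   differentiation theorems make T_i differentiable almost everywhere. Where in
   addition Q <> 0, non-idling gives Y' = 0, and w Q has derivative -1. *)

Require Import Defs.
From HB Require Import structures.
From mathcomp Require Import all_boot all_order all_algebra.
From mathcomp Require Import all_classical all_reals all_analysis.
From mathcomp Require Import complex ring lra.

Set Implicit Arguments.
Unset Strict Implicit.
Unset Printing Implicit Defensive.

Import Order.TTheory GRing.Theory Num.Theory.
Import numFieldNormedType.Exports.

Local Open Scope classical_set_scope.
Local Open Scope ring_scope.

(** * Almost everywhere differentiability of monotone 1-Lipschitz functions *)

(** Both measures are infima over covers by half-open intervals, and the Lipschitz bound compares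
    the two lengths of each interval. *)
Lemma lebesgue_stieltjes_le_lebesgue (R : realType) (F : cumulative R R)
    (F_lip : forall s t, s <= t -> F t - F s <= t - s)
    (A : set (measurableTypeR R)) :
  (lebesgue_stieltjes_measure F A <= lebesgue_measure A)%E.
Proof.
apply: le_ereal_inf_tmp => _ [B [mB AB] <-].
apply: ge_ereal_inf; exists (\sum_(0 <= k <oo) wlength F (B k))%E.
  by exists B.
apply: lee_nneseries => [k _ _|k _]; first exact: wlength_ge0.
have [->|[[a b] /= ab ->]] := (ocitvP _).1 (mB k); first by rewrite !wlength0.
by rewrite !wlength_itv_bnd ?(ltW ab)// lee_fin F_lip // ltW.
Qed.

Lemma nondecreasing_lipschitz_ae_derivable (R : realType) (F : R -> R)
    (F_nd : {homo F : s t / s <= t})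
    (F_lip : forall s t, s <= t -> F t - F s <= t - s) :
  {ae @lebesgue_measure R, forall x : R, derivable F x 1}.
Proof.
have F_rc : right_continuous F.
  apply: right_continuousW => x; apply/cvgrPdist_lt => e e0; near=> y.
  have yx : `|x - y| < e by near: y; exact: (nbhsx_ballx x).
  apply: le_lt_trans yx.
  have [xy|/ltW yx] := leP x y.
    by rewrite distrC (distrC x) !ger0_norm ?subr_ge0 ?F_nd //; exact: F_lip.
  by rewrite !ger0_norm ?subr_ge0 ?F_nd //; exact: F_lip.
pose Fc : cumulative R R := HB.pack F (isCumulative.Build R _ R F F_nd F_rc).
pose nu := lebesgue_stieltjes_measure Fc.
have nu_itv a b : a <= b -> nu `]a, b]%classic = (F b - F a)%:E.
  move=> ab; rewrite /nu /lebesgue_stieltjes_measure /measure_extension.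
  by rewrite measurable_mu_extE/= ?wlength_itv_bnd//; exact: is_ocitv.
(* On []-n, n]] the Stieltjes measure is finite, so its Radon-Nikodym density is integrable; the
   countably many exceptional null sets are then merged. *)
pose D (n : nat) : set (measurableTypeR R) := `]- n%:R, n%:R]%classic.
have mD n : measurable (D n) by apply: sub_sigma_algebra; exact: is_ocitv.
have D_fin n : (nu (D n) < +oo)%E by rewrite nu_itv ?ltry ?ge0_cp.
suff ae_n n : {ae @lebesgue_measure R, forall x : R,
    - n%:R < x < n%:R -> derivable F x 1}.
  have := ae_foralln ae_n; apply: filterS.
  move=> x /(_ (Num.bound `|x|)); apply.
  by rewrite -ltr_norml; exact: archi_boundP (normr_ge0 x).
pose nun : {finite_measure set _ -> \bar R} := mfrestr (mD n) (D_fin n).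
have nun_dom : nun `<< @lebesgue_measure R.
  apply/null_content_dominatesP => A mA A0.
  apply/eqP; rewrite eq_le measure_ge0 andbT -A0.
  apply: le_trans (lebesgue_stieltjes_le_lebesgue (F := Fc) F_lip A).
  by apply: le_measure; rewrite ?inE //; exact: measurableI.
have [f [f_ge0 f_fin f_int f_E]] := radon_nikodym_sigma_finite nun_dom.
pose g := fine \o f.
have gE : EFin \o g = f by apply/funext => x; rewrite /= fineK.
have g_loc : locally_integrable [set: R] g.
  by apply: open_integrable_locally; [exact: openT|rewrite gE].
have g_int y : (@lebesgue_measure R).-integrable
    [set` Interval (BRight (- n%:R)) (BRight y)] (EFin \o g).
  by rewrite gE; apply: integrableS f_int.
have := FTC1 g_int g_loc.
apply: (@filterS _ _ (ae_filter_ringOfSetsType (@lebesgue_measure R))).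
move=> x + /andP[nx xn]; rewrite lte_fin => /(_ nx)[+ _].
(* Near [x], [F] is [F (- n%:R)] plus the integral of its density, so it inherits the derivability
   given by [FTC1]. *)
have E : {near x, (fun y => F (- n%:R) + 
   (\int[lebesgue_measure]_(t in `]- n%:R, y]) g t)%R) =1 F}.
  near=> y; apply/esym.
  have ny : - n%:R < y by near: y; exact: lt_nbhsr.
  have yn : y < n%:R by near: y; exact: lt_nbhsl.
  have mI : measurable (`]- n%:R, y]%classic : set (measurableTypeR R)).
    by apply: sub_sigma_algebra; exact: is_ocitv.
  have -> : (\int[lebesgue_measure]_(t in `]- n%:R, y]) g t)%R =
      fine (nun `]- n%:R, y]%classic).
    by rewrite f_E // -gE.
  rewrite /= /mfrestr /mrestr setIidl; last first.
    by apply: subset_itvl; rewrite bnd_simp ltW.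
  by rewrite [X in fine X](nu_itv _ _ (ltW ny)) /= subrKC.
move=> dg; apply: (near_eq_derivable E).
by apply: derivableD.
Unshelve. all: by end_near. Qed.

(** * Matrices with nonnegative inverse *)

(** Over a field, equivalent to invertibility with an entrywise nonnegative inverse (a monotone
    matrix); this form can be stated before invertibility is known. *)
Definition inverse_positive (R : numDomainType) (n : nat) (A : 'M[R]_n) :=
  forall x : 'cV[R]_n, (forall i, 0 <= (A *m x) i 0) -> forall i, 0 <= x i 0.

(** A kernel vector [x] and its opposite both have nonnegative image, so [x >= 0] and [- x >= 0]. *)
Lemma inverse_positive_unitmx (R : numFieldType) (n : nat) (A : 'M[R]_n) :
  inverse_positive A -> A \in unitmx.
Proof.
move=> Apos; rewrite -unitmx_tr -row_free_unit -kermx_eq0.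
apply/eqP/row_matrixP => i; rewrite row0; apply: trmx_inj; rewrite trmx0.
set x := (row i _)^T.
have Ax : A *m x = 0.
  by apply: trmx_inj; rewrite trmx_mul trmxK -row_mul mulmx_ker row0 trmx0.
clearbody x; have x_ge0 := Apos x; have Nx_ge0 := Apos (- x).
apply/colP => j; apply: le_anti; rewrite mxE; apply/andP; split; last first.
  by apply: x_ge0 => k; rewrite Ax mxE.
have := Nx_ge0 _ j; rewrite mxE oppr_ge0; apply => k.
by rewrite mulmxN Ax !mxE oppr0.
Qed.

Lemma inverse_positive_ge0 (R : numFieldType) (n : nat) (A : 'M[R]_n) :
  inverse_positive A -> forall i j, 0 <= invmx A i j.
Proof.
move=> Apos i j; have Au := inverse_positive_unitmx Apos.
have := Apos (col j (invmx A)) _ i; rewrite mxE; apply => k.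
by rewrite colE mulmxA mulmxV // mul1mx mxE ler0n.
Qed.

(* Minimum principle: compare both sides at a minimal coordinate of x. *)
Lemma diag_dominant_inverse_positive (R : realFieldType) (n : nat)
    (A : 'M[R]_n) (s : R) (A_ge0 : forall i j, 0 <= A i j)
    (A_lt : forall i, \sum_j A i j < s) :
  inverse_positive (s%:M - A).
Proof.
move=> x Ax_ge0 k; pose i := [arg min_(i < k) x i 0]%O.
have x_min j : x i 0 <= x j 0 by rewrite /i; case: arg_minP => // m _; exact.
apply: le_trans (x_min k).
have := Ax_ge0 i; rewrite mulmxBl mul_scalar_mx !mxE subr_ge0 => le_s.
have : (\sum_j A i j) * x i 0 <= s * x i 0.
  apply: le_trans le_s; rewrite mulr_suml ler_sum // => j _.
  by rewrite ler_wpM2l.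
have s_gt0 : 0 < s - \sum_j A i j by rewrite subr_gt0.
by move=> le_sum; rewrite -(pmulr_rge0 _ s_gt0) mulrBl subr_ge0.
Qed.

(** Factor [A - e%:M] as [A (1 - e A^-1)]: for small [e] the row sums of [e A^-1] are below 1, and
    the minimum principle applies to the second factor. *)
Lemma inverse_positive_left (R : realFieldType) (n : nat) (A : 'M[R]_n) :
  inverse_positive A ->
  exists2 d : R, 0 < d & forall e, 0 <= e < d -> inverse_positive (A - e%:M).
Proof.
move=> Apos; have Au := inverse_positive_unitmx Apos.
have V_ge0 := inverse_positive_ge0 Apos.
pose S := \sum_i \sum_j invmx A i j.
have S_ge0 : 0 <= S by do 2!apply: sumr_ge0 => ? _.
(* [S] bounds every row sum of [A^-1]; adding 1 makes the denominator positive. *)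
exists (1 + S)^-1; first by rewrite invr_gt0 ltr_wpDr.
move=> e /andP[e_ge0 e_lt] x Ax_ge0.
apply: (@diag_dominant_inverse_positive _ _ (e *: invmx A) 1).
- by move=> i j; rewrite mxE mulr_ge0.
- move=> i; under eq_bigr do rewrite mxE.
  rewrite -mulr_sumr; apply: (@le_lt_trans _ _ (e * (1 + S))).
    rewrite ler_wpM2l // [in leRHS]/S [X in 1 + X](bigD1 i) //=.
    by rewrite addrCA lerDl addr_ge0 // sumr_ge0 // => j _; rewrite sumr_ge0.
  by rewrite -ltr_pdivlMr ?mul1r // ltr_wpDr.
- apply: Apos => i.
  by rewrite mulmxA mulmxBr -scalemxAr mulmxV // mulmx1 scalemx1 Ax_ge0.
Qed.

(* Perturbing x along u = A^-1 1 makes A x strictly positive, which absorbs the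
   shift by e. *)
Lemma inverse_positive_lim (R : realFieldType) (n : nat) (A : 'M[R]_n) :
  A \in unitmx -> (forall e, 0 < e -> inverse_positive (A + e%:M)) ->
  inverse_positive A.
Proof.
move=> Au Apos x Ax_ge0 i.
pose u : 'cV[R]_n := invmx A *m const_mx 1.
have Au1 : A *m u = const_mx 1 by rewrite mulKVmx.
clearbody u; suff xu_ge0 r : 0 < r -> 0 <= x i 0 + r * u i 0.
  rewrite leNgt; apply/negP => x_lt0.
  have c_gt0 : 0 < 1 + `|u i 0| by rewrite ltr_pwDl.
  (* This choice gives [x i 0 + r * u i 0 <= - r < 0]. *)
  pose r := - x i 0 / (1 + `|u i 0|).
  have r_gt0 : 0 < r by rewrite divr_gt0 // oppr_gt0.
  have rc : r * (1 + `|u i 0|) = - x i 0 by rewrite divfK // gt_eqF.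
  have := xu_ge0 _ r_gt0; have := ler_norm (u i 0).
  rewrite -(ler_pM2l r_gt0); lra.
move=> r_gt0; pose y := x + r *: u.
have Ay j : r <= (A *m y) j 0.
  have -> : (A *m y) j 0 = (A *m x) j 0 + r.
    by rewrite mulmxDr -scalemxAr Au1 !mxE mulr1.
  by rewrite lerDr.
have -> : x i 0 + r * u i 0 = y i 0 by rewrite !mxE.
clearbody y.
pose S := 1 + \sum_j `|y j 0|.
have S_gt0 : 0 < S by rewrite ltr_pwDl // sumr_ge0.
have := Apos (r / S) (divr_gt0 r_gt0 S_gt0) y _ i; apply => j.
have yS : `|y j 0| <= S.
  by rewrite /S [X in 1 + X](bigD1 j) //= addrCA lerDl addr_ge0 // sumr_ge0.
rewrite mulmxDl mul_scalar_mx mxE [X in _ + X]mxE.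
apply: le_trans (_ : r + r / S * y j 0 <= _); last by rewrite lerD2r.
have -> : r + r / S * y j 0 = r / S * (S + y j 0) by field; rewrite gt_eqF.
rewrite mulr_ge0 ?divr_ge0 ?(ltW r_gt0) ?(ltW S_gt0) //.
by rewrite addrC -lerBlDr sub0r; move: yS; rewrite ler_norml => /andP[].
Qed.

(* Start from s large, where the minimum principle applies, and decrease s to 1:
   inverse positivity of s I - A survives limits and small decrements of s. *)
Lemma unitmx_ge1_inverse_positive (R : realType) (n : nat)
    (A : 'M[R]_n) (A_ge0 : forall i j, 0 <= A i j)
    (A_unit : forall s, 1 <= s -> s%:M - A \in unitmx) :
  inverse_positive (1%:M - A).
Proof.
apply: contrapT => not1.
(* [E] collects the bad parameters. Its supremum is good as a limit from the right, hence so are the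
   parameters just below it, although elements of [E] come arbitrarily close to it. *)
pose E := [set s | 1 <= s /\ ~ inverse_positive (s%:M - A)].
have E1 : E 1 by split.
have E_ub : ubound E (\sum_i \sum_j A i j).
  move=> s [_ nots]; rewrite leNgt; apply/negP => lts; apply: nots.
  apply: diag_dominant_inverse_positive => // i; apply: le_lt_trans lts.
  by rewrite [leRHS](bigD1 i) //= lerDl sumr_ge0 // => j _; rewrite sumr_ge0.
have E_sup : has_sup E by split; [exists 1|exists (\sum_i \sum_j A i j)].
have sup_ge1 : 1 <= sup E by apply: ub_le_sup => //; case: E_sup.
have sup_pos : inverse_positive ((sup E)%:M - A).
  apply: inverse_positive_lim; first exact: A_unit.
  move=> e e_gt0; rewrite addrAC -raddfD; apply: contrapT => note.
  have : sup E + e <= sup E.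
    apply: ub_le_sup; first by case: E_sup.
    by split=> //; rewrite ler_wpDr // ltW.
  by rewrite gerDl leNgt e_gt0.
have [d d_gt0 dpos] := inverse_positive_left sup_pos.
have [s [s_ge1 nots] s_lt] := sup_adherent d_gt0 E_sup.
have s_le : s <= sup E.
  by apply: ub_le_sup; [case: E_sup|split].
apply: nots; have -> : s%:M - A = (sup E)%:M - A - (sup E - s)%:M.
  by rewrite addrAC -raddfB subKr.
by apply: dpos; rewrite subr_ge0 s_le ltrBlDr addrC -ltrBlDr.
Qed.

(** * Spectral radius and invertibility *)

Lemma eigenvalue_le_spectral_radius (R : realType) (n : nat) (A : 'M[R]_n)
    (z : R[i]) :
  eigenvalue (map_mx (real_complex R) A) z ->
  ComplexField.Normc.normc z <= spectral_radius A.
Proof.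
move=> Az; rewrite /spectral_radius; apply: ub_le_sup; last by exists z.
(* [sup] is known to dominate only a bounded set: eigenvalues are roots of the characteristic
   polynomial, so the sum of the moduli of its roots is a bound. *)
have [r rE] := closed_field_poly_normal (char_poly (map_mx (real_complex R) A)).
exists (\sum_(x <- r) ComplexField.Normc.normc x) => _ [y /= + <-].
rewrite eigenvalue_root_char rE (monicP (char_poly_monic _)) scale1r.
rewrite root_prod_XsubC => yr.
rewrite (big_rem y) //= lerDl sumr_ge0 // => -[a b] _.
exact: sqrtr_ge0.
Qed.

(** Otherwise [s] is a real eigenvalue, and remains one over [R[i]] because the characteristic
    polynomial commutes with the embedding; its modulus is [s]. *)
Lemma spectral_radius_lt_unitmx (R : realType) (n : nat) (A : 'M[R]_n) (s : R) :
  0 <= s -> spectral_radius A < s -> s%:M - A \in unitmx.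
Proof.
move=> s_ge0; apply: contraTT => notu; rewrite -leNgt.
have -> : s = ComplexField.Normc.normc (real_complex R s).
  by rewrite /= expr0n /= addr0 sqrtr_sqr ger0_norm.
apply: eigenvalue_le_spectral_radius.
rewrite eigenvalue_root_char -map_char_poly fmorph_root -eigenvalue_root_char.
rewrite /eigenvalue /eigenspace kermx_eq0 row_free_unit -opprB -scaleN1r.
by rewrite unitmxZ ?unitrN1.
Qed.

(** * Absolute continuity *)

Lemma lipschitz_absolutely_continuous_on (R : realType) (J : set R)
    (f : R -> R) (L : R) :
  (forall s t, J s -> J t -> s <= t -> `|f t - f s| <= L * (t - s)) ->
  absolutely_continuous_on J f.
Proof.
move=> f_lip eps eps_gt0.
have L_gt0 : 0 < 1 + `|L| by rewrite ltr_pwDl.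
exists (eps / (1 + `|L|)); first exact: divr_gt0.
move=> n a b Jab _; rewrite ltr_pdivlMr // mulrC => sum_lt.
apply: le_lt_trans sum_lt; rewrite mulr_sumr ler_sum // => i _.
have [Ja Jb ab] := Jab i; apply: le_trans (f_lip _ _ Ja Jb ab) _.
by rewrite ler_wpM2r ?subr_ge0 // (le_trans (ler_norm L)) // lerDr.
Qed.

(** * Algebra of the model parameters and of the weight vector *)

Section FluidModel.
Variables (R : realType) (K : nat) (Lambda : 'M[R]_K) (lambda0 : 'cV[R]_K).
Variable mu : 'rV[R]_K.
Hypothesis mu_gt0 : forall i, 0 < mu 0 i.

Let G := rate_mx mu.
Let M := mean_mx Lambda mu.
Let H := conj_mean_mx Lambda mu.

Lemma invmx_rate_mx : invmx G = diag_mx (map_mx GRing.inv mu).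
Proof.
have GV : G *m diag_mx (map_mx GRing.inv mu) = 1%:M.
  rewrite mulmx_diag -diag_const_mx; congr diag_mx; apply/rowP => i.
  by rewrite !mxE divff // gt_eqF.
have [Gu _] := mulmx1_unit GV.
by rewrite -[RHS](mulKmx Gu) GV mulmx1.
Qed.

Lemma rate_mx_unit : G \in unitmx.
Proof.
rewrite unitmxE det_diag unitfE; apply/prodf_neq0 => i _.
by rewrite gt_eqF.
Qed.

(** [G] is diagonal, hence symmetric, so [H^T] is the conjugate [G^-1 M^T G] of [M^T]. *)
Lemma tr_conj_mean_mx : 1%:M - H^T = invmx G *m (1%:M - M^T) *m G.
Proof.
rewrite mulmxBr mulmx1 mulmxBl mulVmx ?rate_mx_unit //.
rewrite /H /conj_mean_mx -/G -/M !trmx_mul trmx_inv mulmxA.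
by rewrite /G /rate_mx tr_diag_mx.
Qed.

Section Weights.
Hypothesis Lambda_ge0 : forall i j, 0 <= Lambda i j.
Hypothesis rho_lt1 : spectral_radius M < 1.

Lemma mean_mx_ge0 i j : 0 <= M i j.
Proof.
rewrite /M /mean_mx -/G invmx_rate_mx mul_diag_mx !mxE.
by rewrite mulr_ge0 // invr_ge0 ltW.
Qed.

Lemma mean_mx_inverse_positive : inverse_positive (1%:M - M).
Proof.
apply: unitmx_ge1_inverse_positive; first exact: mean_mx_ge0.
move=> s s_ge1; apply: spectral_radius_lt_unitmx.
  by rewrite (le_trans _ s_ge1).
by rewrite (lt_le_trans _ s_ge1).
Qed.

Lemma conj_mean_mx_unit : 1%:M - H^T \in unitmx.
Proof.
rewrite tr_conj_mean_mx !unitmx_mul unitmx_inv rate_mx_unit andbT /=.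
rewrite -unitmx_tr linearB /= trmxK trmx1.
exact: inverse_positive_unitmx mean_mx_inverse_positive.
Qed.

Definition lyapunov_row : 'rV[R]_K :=
  (const_mx 1 : 'cV[R]_K)^T *m invmx (1%:M - H^T) *m invmx G.

Lemma lyapunov_rowE : lyapunov_row *m (1%:M - M^T) *m G = const_mx 1.
Proof.
have -> : lyapunov_row *m (1%:M - M^T) *m G =
    (const_mx 1 : 'cV[R]_K)^T *m invmx (1%:M - H^T) *m (1%:M - H^T).
  by rewrite [X in _ = _ *m X]tr_conj_mean_mx /lyapunov_row !mulmxA.
by rewrite mulmxKV ?conj_mean_mx_unit // trmx_const.
Qed.

(** [w^T] solves [(I - M) w^T = G^-1 e], so inverse positivity gives [w >= 0]; then
    [w^T = G^-1 e + M w^T] is at least [G^-1 e], which gives strictness. *)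
Lemma lyapunov_row_gt0 i : 0 < lyapunov_row 0 i.
Proof.
set w := lyapunov_row.
have wE : (1%:M - M) *m w^T = (map_mx GRing.inv mu)^T.
  apply: trmx_inj; rewrite trmxK trmx_mul trmxK linearB /= trmx1.
  rewrite -[LHS](mulmxK rate_mx_unit) lyapunov_rowE invmx_rate_mx.
  by apply/rowP => j; rewrite mul_mx_diag !mxE mul1r.
have w_ge0 j : 0 <= w 0 j.
  have := mean_mx_inverse_positive (x := w^T); rewrite wE => /(_ _ j).
  by rewrite mxE; apply => k; rewrite !mxE invr_ge0 ltW.
clearbody w; have := congr1 (fun A : 'cV_K => A i 0) wE.
rewrite mulmxBl mul1mx !mxE => /eqP; rewrite subr_eq => /eqP ->.
rewrite ltr_pwDl ?invr_gt0 //.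
apply: sumr_ge0 => j _; apply: mulr_ge0; first exact: mean_mx_ge0.
by rewrite mxE.
Qed.

End Weights.

(** * Trajectories of a fluid solution *)

Section Solution.
Variables (Q T : R -> 'cV[R]_K) (Y : R -> R).
Hypothesis QTY : fluid_solution Lambda lambda0 mu Q T Y.

(** Monotonicity of [Y] bounds the total increment of all the [T_j] by [t - s], and no single
    increment exceeds the total because all are nonnegative. *)
Lemma fluid_T_lipschitz i s t : 0 <= s -> s <= t ->
  T t i 0 - T s i 0 <= t - s.
Proof.
move=> s_ge0 st; have := fluid_Y_nondecreasing QTY s_ge0 st.
rewrite !(fluid_Y_def QTY) ?(le_trans s_ge0 st) // => Yst.
have : T t i 0 - T s i 0 <= \sum_j (T t j 0 - T s j 0).
  rewrite (bigD1 i) //= lerDl sumr_ge0 // => j _.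
  by rewrite subr_ge0 (fluid_T_nondecreasing QTY).
rewrite sumrB; lra.
Qed.

Lemma fluid_Y_lipschitz s t : 0 <= s -> s <= t -> `|Y t - Y s| <= t - s.
Proof.
move=> s_ge0 st; rewrite ger0_norm; last first.
  by rewrite subr_ge0 (fluid_Y_nondecreasing QTY).
rewrite !(fluid_Y_def QTY) ?(le_trans s_ge0 st) //.
have : \sum_j T s j 0 <= \sum_j T t j 0.
  by apply: ler_sum => j _; exact: (fluid_T_nondecreasing QTY).
lra.
Qed.

Lemma fluid_T_ae_derivable :
  {ae @lebesgue_measure R, forall t : R, 0 < t ->
    forall i, derivable (fun s => T s i 0) t 1}.
Proof.
(* Freezing [T] at its value at 0 on negative times makes [F i] monotone and 1-Lipschitz on the
   whole line, without changing it near [t > 0]. *)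
pose F i s := T (Num.max 0 s) i 0.
have maxE (s t : R) : s <= t -> Num.max 0 s <= Num.max 0 t.
  by move=> st; rewrite ge_max le_max lexx /= le_max st orbT.
have F_ae i : {ae @lebesgue_measure R, forall t : R, derivable (F i) t 1}.
  apply: nondecreasing_lipschitz_ae_derivable => s t st.
    apply: (fluid_T_nondecreasing QTY); last exact: maxE.
    by rewrite le_max lexx.
  apply: le_trans (fluid_T_lipschitz _ _ (maxE _ _ st)) _.
    by rewrite le_max lexx.
  case: (leP 0 s); case: (leP 0 t); lra.
have := filter_forall (ae_filter_ringOfSetsType (@lebesgue_measure R)) F_ae.
apply: filterS => t dF t_gt0 i; apply: near_eq_derivable (dF i).
near=> s; rewrite /F max_r // ltW //.
by near: s; exact: lt_nbhsr.
Unshelve. all: by end_near. Qed.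

(** The effort term of the fluid equation contributes [- \sum_i T t i 0], which is [Y t - t]. *)
Lemma weighted_content (w : 'rV[R]_K) t : 0 <= t ->
  w *m (1%:M - M^T) *m G = const_mx 1 ->
  (w *m Q t) 0 0 =
    (w *m Q 0) 0 0 - t + (1 + (w *m lambda0) 0 0) * Y t.
Proof.
move=> t_ge0 wE; rewrite {1}(fluid_equation QTY t_ge0) -/G -/M !mulmxDr.
rewrite mulmxA mulmxA -(opprB 1%:M) mulmxN !mulNmx wE -scalemxAr.
have -> : const_mx 1 *m T t = (\sum_i T t i 0)%:M.
  apply/matrixP => i j; rewrite !ord1 !mxE mulr1n.
  by apply: eq_bigr => k _; rewrite mxE mul1r.
move: (w *m Q 0) (w *m lambda0) => a b.
by rewrite !mxE /= mulr1n (fluid_Y_def QTY t_ge0); ring.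
Qed.

Lemma weighted_content_absolutely_continuous (w : 'rV[R]_K) :
  w *m (1%:M - M^T) *m G = const_mx 1 ->
  absolutely_continuous_on `[0, +oo[ (fun t => (w *m Q t) 0 0).
Proof.
move=> wE.
apply: (@lipschitz_absolutely_continuous_on _ _ _
  (1 + `|1 + (w *m lambda0) 0 0|)) => s t.
rewrite /= !in_itv /= !andbT => s_ge0 t_ge0 st.
rewrite (weighted_content t_ge0 wE) (weighted_content s_ge0 wE).
set c := (w *m lambda0) 0 0.
have -> a : a - t + (1 + c) * Y t - (a - s + (1 + c) * Y s) =
  - (t - s) + (1 + c) * (Y t - Y s) by ring.
apply: le_trans (ler_normD _ _) _.
rewrite normrN normrM [`|t - s|]ger0_norm ?subr_ge0 // mulrDl mul1r lerD2l.
by rewrite ler_wpM2l // fluid_Y_lipschitz.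
Qed.

Lemma weighted_content_derive (w : 'rV[R]_K) :
  w *m (1%:M - M^T) *m G = const_mx 1 ->
  {ae @lebesgue_measure R, forall t : R, 0 < t -> Q t != 0 ->
    is_derive t 1 (fun s => (w *m Q s) 0 0) (-1)}.
Proof.
move=> wE.
have aeF := ae_filter_ringOfSetsType (@lebesgue_measure R).
have := @filterI _ _ aeF _ _ fluid_T_ae_derivable (fluid_non_idling QTY).
apply: (@filterS _ _ aeF) => t [dT sumT] t_gt0 Qt.
have {sumT} := sumT t_gt0 Qt; have {}dT := dT t_gt0.
set c := (w *m lambda0) 0 0.
have dsum := @is_derive_sum _ _ _ _ (fun i s => T s i 0) t 1 _
  (fun i => derivableP (dT i)).
under eq_bigr do rewrite derive1E.
move=> sumT; rewrite sumT in dsum.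
(* Once [Y] is substituted, the function is a constant plus [c * s - (1 + c) * \sum_i T s i 0], and
   non-idling gives the sum slope 1. *)
have -> : -1 = c *: 1 - (1 + c) *: 1 :> R by rewrite /GRing.scale /=; ring.
have d := is_deriveD (is_derive_cst ((w *m Q 0) 0 0) t 1)
  (is_deriveB (is_deriveZ c (is_derive_id t 1)) (is_deriveZ (1 + c) dsum)).
rewrite add0r in d; apply: near_eq_is_derive d.
near=> s; have s_ge0 : 0 <= s by apply: ltW; near: s; exact: lt_nbhsr.
rewrite (weighted_content s_ge0 wE) (fluid_Y_def QTY s_ge0) -/c.
rewrite !fctE fct_sumE /=; set S := \sum_(i < K) _.
have -> : c *: s - (1 + c) *: S = c * s - (1 + c) * S :> R by [].
ring.
Unshelve. all: by end_near. Qed.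

End Solution.
End FluidModel.

Theorem theorem1 (R : realType) (K : nat) (Lambda : 'M[R]_K)
    (lambda0 : 'cV[R]_K) (mu : 'rV[R]_K)
    (K_ge1 : (1 <= K)%N)
    (Lambda_ge0 : forall i j, 0 <= Lambda i j)
    (lambda0_ge0 : forall j, 0 <= lambda0 j 0)
    (mu_gt0 : forall i, 0 < mu 0 i)
    (rho_lt1 : spectral_radius (mean_mx Lambda mu) < 1) :
  let e : 'cV[R]_K := const_mx 1 in
  let G := rate_mx mu in
  let H := conj_mean_mx Lambda mu in
  1%:M - H^T \in unitmx /\
  lyapunov_function Lambda lambda0 mu
    (fun q : 'cV[R]_K => (e^T *m invmx (1%:M - H^T) *m invmx G *m q) 0 0).
Proof.
move=> e G H; have [wu wE w_gt0] : [/\ 1%:M - H^T \in unitmx,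
    lyapunov_row Lambda mu *m (1%:M - (mean_mx Lambda mu)^T) *m G = const_mx 1 &
    forall i, 0 < lyapunov_row Lambda mu 0 i].
  split; [exact: conj_mean_mx_unit|exact: lyapunov_rowE|].
  exact: lyapunov_row_gt0.
split=> //; split=> [Q T Y QTY|]; last first.
  (* The slope is exactly -1 for every solution, so 1 is a uniform choice. *)
  exists 1 => // Q T Y QTY.
  have := weighted_content_derive QTY wE.
  apply: (@filterS _ _ (ae_filter_ringOfSetsType (@lebesgue_measure R))).
  move=> t dt t_gt0 Qt; have d := dt t_gt0 Qt.
  by rewrite derive1E (@derive_val _ _ _ _ _ _ _ d).
have wQ_ge0 t i : 0 <= t -> 0 <= lyapunov_row Lambda mu 0 i * Q t i 0.
  by move=> t_ge0; rewrite mulr_ge0 ?(fluid_Q_ge0 QTY) // ltW.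
split=> [t t_ge0|t t_ge0|].
- by rewrite mxE sumr_ge0 // => i _; exact: wQ_ge0.
- split=> [|->]; last by rewrite mulmx0 mxE.
  rewrite mxE => /eqP; rewrite psumr_eq0; last by move=> i _; exact: wQ_ge0.
  move=> /allP Q0; apply/colP => i; rewrite mxE; apply/eqP.
  have := Q0 i (mem_index_enum i); rewrite /= mulf_eq0.
  by rewrite gt_eqF //; exact: w_gt0.
- have := weighted_content_absolutely_continuous QTY wE; exact.
Qed.
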